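(* The only primitive formally dual set of rank one (in any finite abelian group) is $\{1\}$ in the trivial group $G=\{1\}$.
   Context: For a finite abelian group $G$ and a group isomorphism $\Delta:G\to\widehat G$, $y\mapsto\chi_y$, subsets $S,T\subseteq G$ form a formally dual pair if for all $y\in G$: $|\chi_y(S)|^2=\frac{|S|^2}{|T|}\nu_T(y)$ and $|\chi_y(T)|^2=\frac{|T|^2}{|S|}\nu_S(y)$, where $\chi(A)=\sum_{a\in A}\chi(a)$ and $\nu_A(y)=|\{(a_1,a_2)\in A\times A\mid y=a_1a_2^{-1}\}|$. A subset is primitive if it is not contained in a coset of a proper subgroup and is not a union of cosets of a nontrivial subgroup; $S$ is a primitive formally dual set if there exist such $\Delta$ and $T$ with both $S$ and $T$ primitive. $S$ is an even set if, in the group ring $\mathbb{Z}[G]$, $SS^{(-1)}=\sum_{i=1}^r\lambda_iH_i$ for some subgroups $H_i$ (identified with the sum of their elements) and nonzero integers $\lambda_i$, where $S^{(-1)}=\sum_{s\in S}s^{-1}$; its rank is the smallest such $r$. *)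

(* Defs.v *)
From HB Require Import structures.
From mathcomp Require Import all_boot all_order all_algebra all_fingroup.
From mathcomp Require Import all_solvable all_field all_character.

Set Implicit Arguments.
Unset Strict Implicit.
Unset Printing Implicit Defensive.

Import Order.TTheory GRing.Theory Num.Theory GroupScope.
Local Open Scope ring_scope.

Section FormalDuality.

Variables (gT : finGroupType) (G : {group gT}).

(* The dual group of G is carried by the linear characters of G, under the
   pointwise product; they take values in algC since G is finite.  The values
   of chi outside G play no role. *)
Definition dual_isom (chi : gT -> 'CF(G)) : Prop :=
  [/\ forall y, y \in G -> chi y \is a linear_char,
      {in G &, {morph chi : x y / (x * y)%g >-> x * y}},
      {in G &, injective chi}
    & forall xi : 'CF(G), xi \is a linear_char -> exists2 y, y \in G & chi y = xi].

Definition char_sum (xi : 'CF(G)) (A : {set gT}) : algC := \sum_(a in A) xi a.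

Definition weight (A : {set gT}) (y : gT) : nat :=
  #|[set a in setX A A | y == (a.1 * a.2^-1)%g]|.

(* Nonemptiness is what makes the quotients by #|S| and #|T| meaningful. *)
Definition formally_dual_pair (chi : gT -> 'CF(G)) (S T : {set gT}) : Prop :=
  [/\ S \subset G, T \subset G, S != set0, T != set0 &
      forall y, y \in G ->
           `|char_sum (chi y) S| ^+ 2
             = #|S|%:R ^+ 2 / #|T|%:R * (weight T y)%:R
        /\ `|char_sum (chi y) T| ^+ 2
             = #|T|%:R ^+ 2 / #|S|%:R * (weight S y)%:R].

Definition in_proper_coset (S : {set gT}) : Prop :=
  exists H : {group gT}, H \proper G /\ exists2 x, x \in G & S \subset H :* x.

Definition union_of_cosets (S : {set gT}) : Prop :=
  exists H : {group gT}, [/\ H \subset G, H :!=: 1%g &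
    exists2 P : {set {set gT}}, P \subset rcosets H G & S = cover P].

Definition primitive_set (S : {set gT}) : Prop :=
  ~ in_proper_coset S /\ ~ union_of_cosets S.

Definition primitive_formally_dual_set (S : {set gT}) : Prop :=
  exists chi : gT -> 'CF(G), exists T : {set gT},
    [/\ dual_isom chi, formally_dual_pair chi S T,
        primitive_set S & primitive_set T].

(* The group ring Z[G] is realised, as in mxrepresentation, inside the matrix
   ring 'M[int]_#|G| by the (faithful) regular representation, under which the
   elements of G are linearly independent; gring_set is gset_mx, which the
   library only provides over a field. *)
Definition gring_set (A : {set gT}) : 'M[int]_#|G| :=
  \sum_(x in A) regular_repr int G x.

Definition gring_setV (A : {set gT}) : 'M[int]_#|G| :=
  \sum_(x in A) regular_repr int G (x^-1)%g.

Definition even_decomposition (S : {set gT}) (r : nat) : Prop :=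
  exists (H : 'I_r -> {group gT}) (lambda : 'I_r -> int),
    [/\ forall i, H i \subset G, forall i, lambda i != 0 &
        gring_set S *m gring_setV S = \sum_(i < r) lambda i *: gring_set (H i)].

Definition even_set_of_rank (S : {set gT}) (r : nat) : Prop :=
  even_decomposition S r
  /\ (forall r', even_decomposition S r' -> (r <= r')%N).

End FormalDuality.

(* Main.v *)
(* If S S^(-1) = lambda H in Z[G], then comparing supports puts S inside a
   coset of H, so H = G by primitivity.  Comparing coefficients, every y in G
   is a quotient of elements of S in as many ways as 1 is, namely |S|, which
   means S y = S; hence S = G is a coset of itself and, again by primitivity,
   G is trivial. *)
Require Import Defs.
From mathcomp Require Import all_boot all_order all_algebra all_fingroup.
From mathcomp Require Import all_solvable all_field all_character.

Set Implicit Arguments.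
Unset Strict Implicit.
Unset Printing Implicit Defensive.

Import Order.TTheory GRing.Theory Num.Theory GroupScope.

Section GroupRing.

Local Open Scope ring_scope.

Variables (gT : finGroupType) (G : {group gT}).
Implicit Types (A : {set gT}) (x y : gT).

(* The coefficient of y in an element of Z[G] is read off the row of index 1
   of its matrix, which encodes the product of that element with 1. *)
Lemma regular_repr_row1 x y : x \in G -> y \in G ->
  regular_repr int G x (gring_index G 1%g) (gring_index G y) = (x == y)%:R.
Proof.
move=> Gx Gy; rewrite !mxE eqxx /= gring_indexK ?group1 // mul1g.
by rewrite (inj_in_eq (can_in_inj (@gring_indexK _ G))) // eq_sym.
Qed.

Lemma gring_set_row1 A y : A \subset G -> y \in G ->
  gring_set G A (gring_index G 1%g) (gring_index G y) = (y \in A)%:R.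
Proof.
move=> /subsetP sAG Gy; rewrite summxE.
rewrite (eq_bigr (fun x => (x == y)%:R)) => [|x Ax]; last first.
  by rewrite regular_repr_row1 // (sAG x).
case: (boolP (y \in A)) => Ay; last first.
  by apply: big1 => x Ax; case: eqP => // Dx; rewrite -Dx Ax in Ay.
by rewrite (bigD1 y) //= eqxx big1 ?addr0 // => x /andP[_ /negPf->].
Qed.

(** Expanding the product, each pair [(a, b)] contributes the matrix of [a * b^-1], whose entry here
    is 1 exactly when that quotient is [y]. This turns an identity in the group ring into a count of
    quotients. *)
Lemma gring_set_mulV_row1 A y : A \subset G -> y \in G ->
  (gring_set G A *m gring_setV G A) (gring_index G 1%g) (gring_index G y)
    = (weight A y)%:R.
Proof.
move=> /subsetP sAG Gy; rewrite mulmx_suml summxE.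
under eq_bigr => a Aa do rewrite mulmx_sumr summxE.
rewrite pair_big_dep /=.
rewrite (eq_bigr (fun a : gT * gT => (y == (a.1 * a.2^-1)%g)%:R)) => [|a /andP[A1 A2]].
  rewrite -natr_sum /weight -sum1_card -big_mkcondr /=.
  by congr (_ %:R); apply: eq_bigl => a; rewrite !inE.
have [G1 G2] : a.1 \in G /\ a.2 \in G by rewrite !sAG.
by rewrite -repr_mxM ?groupV // regular_repr_row1 ?groupM ?groupV // eq_sym.
Qed.

Lemma weight1 A : weight A 1%g = #|A|.
Proof.
(* The pairs with quotient 1 are those on the diagonal. *)
rewrite -(card_imset A (f := fun a => (a, a))) => [|a b [] //].
apply: eq_card => -[a b]; rewrite !inE /=; apply/idP/imsetP => [|[c Ac [-> ->]]].
  by case/andP=> /andP[Aa _]; rewrite eq_sym -eq_mulgV1 => /eqP Dab; exists a; rewrite // -Dab.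
by rewrite Ac mulgV eqxx.
Qed.

Lemma weight_gt0 A a b : a \in A -> b \in A -> (0 < weight A (a * b^-1)%g)%N.
Proof.
by move=> Aa Ab; apply/card_gt0P; exists (a, b); rewrite !inE /= Aa Ab eqxx.
Qed.

(** In a pair counted by [weight A y] the second entry determines the first, so [snd] is injective
    on these pairs. When there are [#|A|] of them, every [a] in [A] occurs as a second entry, and
    its partner [y * a] lies in [A]. *)
Lemma weight_card A y a : weight A y = #|A| -> a \in A -> (y * a)%g \in A.
Proof.
move=> wA Aa; pose B := [set b in setX A A | y == (b.1 * b.2^-1)%g].
have inj2 : {in B &, injective snd}.
  move=> [b1 b2] [c1 c2]; rewrite !inE /= => /andP[_ /eqP Db] /andP[_ /eqP Dc] eq2.
  by rewrite -eq2 in Dc *; congr pair; apply: (mulIg (b2^-1)%g); rewrite -Db.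
have/eqP DA : snd @: B == A.
  rewrite eqEcard (card_in_imset inj2) -[#|B|]/(weight A y) wA leqnn andbT.
  by apply/subsetP => _ /imsetP[[b1 b2] Bb ->]; move: Bb; rewrite !inE => /andP[/andP[]].
move: Aa; rewrite -{1}DA => /imsetP[[b1 b2]]; rewrite !inE /= => /andP[/andP[Ab _] /eqP->] ->.
by rewrite mulgKV.
Qed.

Lemma rank1_primitive_trivial A : A \subset G -> A != set0 ->
  primitive_set G A -> even_decomposition G A 1 -> G :=: 1%g.
Proof.
move=> sAG /set0Pn[a Aa] [notin_coset not_union] [H [lam [sHG _]]].
rewrite big_ord1; set K := H ord0; set l := lam ord0 => DAA.
have sKG : K \subset G := sHG ord0.
(* The weight is thus [l] on [K] and 0 elsewhere. *)
have wA y : y \in G -> (weight A y)%:R = l * (y \in K)%:R.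
  by move=> Gy; rewrite -gring_set_mulV_row1 // DAA mxE gring_set_row1.
have Ga := subsetP sAG a Aa.
have DK : K = G :> {set gT}.
  apply/eqP; apply: contra_notT notin_coset => neqKG; exists K.
  split; first by rewrite properEneq neqKG.
  exists a => //; apply/subsetP => b Ab; rewrite mem_rcoset.
  have := weight_gt0 Ab Aa; have Gb := subsetP sAG b Ab.
  rewrite -(ltr0n int) wA; last by rewrite groupM ?groupV.
  by case: (b * a^-1 \in K)%g; rewrite // mulr0 ltxx.
have wAG y : y \in G -> weight A y = #|A|.
  (* The value of [l] need not be computed: the weights at [y] and at 1 both equal it. *)
  move=> Gy; rewrite -weight1; apply/eqP; rewrite -(eqr_nat int).
  by rewrite !wA ?DK ?Gy ?group1.
have DA : A = G.
  apply/eqP; rewrite eqEsubset sAG; apply/subsetP => y Gy.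
  by rewrite -(mulgKV a y); apply: weight_card Aa; rewrite wAG ?groupM ?groupV.
(* A nontrivial [G] may itself serve as the subgroup, with [G] as the only coset. *)
apply/eqP; apply: contra_notT not_union => ntG; exists G; split => //.
by exists [set (G : {set gT})]; rewrite ?rcosets_id // cover1.
Qed.

End GroupRing.

Section TrivialGroup.

Local Open Scope ring_scope.

Variables (gT : finGroupType) (G : {group gT}).
Hypothesis trivG : G :=: 1%g.

Let memG (y : gT) : y \in G -> y = 1%g.
Proof. by rewrite trivG => /set1P. Qed.

Lemma trivial_primitive_set : primitive_set G 1%g.
Proof.
split=> [[H [/proper_card]]|[H [sHG ntH _]]].
  by rewrite trivG cards1 ltnS leqNgt cardG_gt0.
by rewrite trivG subG1 (negPf ntH) in sHG.
Qed.

Lemma trivial_formally_dual_set : primitive_formally_dual_set G 1%g.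
Proof.
(* The principal character is the only linear character of the trivial group. *)
exists (fun=> 1), 1%g; split; try exact: trivial_primitive_set.
  split=> [y _|x y _ _|x y /memG-> /memG-> //|xi lin_xi].
  - exact: cfun1_lin_char.
  - by rewrite mul1r.
  exists 1%g => //; apply/cfun_inP => x /memG->.
  by rewrite !lin_char1 ?cfun1_lin_char.
have set1n0 : 1%g != set0 :> {set gT} by apply/set0Pn; exists 1%g; rewrite inE.
split; rewrite ?sub1G // => y /memG->.
by rewrite weight1 cards1 /char_sum big_set1 cfun1E group1 normr1 !expr1n !mulr1 divr1.
Qed.

Lemma trivial_even_rank1 : even_set_of_rank G 1%g 1.
Proof.
split=> [|[] // [H [lam [_ _]]]].
  exists (fun=> 1%G), (fun=> 1); split=> //; first by move=> _; apply: sub1G.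
  by rewrite big_ord1 scale1r /gring_set /gring_setV !big_set1 invg1 repr_mx1 mulmx1.
(* Rank 0 would make the product zero, but its coefficient at 1 is 1. *)
rewrite big_ord0 => /matrixP/(_ (gring_index G 1%g) (gring_index G 1%g)).
by rewrite gring_set_mulV_row1 ?sub1G // weight1 cards1 mxE.
Qed.

End TrivialGroup.

Theorem theorem4p16 (gT : finGroupType) (G : {group gT}) (abG : abelian G)
    (S : {set gT}) (sSG : S \subset G) :
  primitive_formally_dual_set G S /\ even_set_of_rank G S 1
  <-> G :=: [set 1%g] /\ S = [set 1%g].
Proof.
split=> [[[chi [T [_ [_ _ S_n0 _ _] primS _]]] [evenS _]]|[trivG ->]].
  have trivG := rank1_primitive_trivial sSG S_n0 primS evenS.
  (* A subset of the trivial group is the singleton or empty, and formal duality excludes the empty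
     set. *)
  split=> //; apply/eqP; rewrite trivG subset1 in sSG.
  by rewrite (negPf S_n0) orbF in sSG.
by split; [exact: trivial_formally_dual_set | exact: trivial_even_rank1].
Qed.
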